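(* Suppose that $h\colon\mathbb{N}_2\to\mathbb{R}_{\ge0}$ is a light weight such that $D_h(1)_1=+\infty$. Then $A_h(1)_1=+\infty$.
   Context: $\mathbb{N}=\{1,2,\dots\}$, $\mathbb{N}_0=\{0,1,2,\dots\}$, and $\mathbb{N}_2=\{e\subset\mathbb{N}:|e|=2\}$. A weight is a map $h\colon\mathbb{N}_2\to\mathbb{C}$ (here with values in $\mathbb{R}_{\ge0}$). A walk of length $n\in\mathbb{N}_0$ is a tuple $w=\langle v_0,\dots,v_n\rangle$ of elements of $\mathbb{N}$ with $v_{i-1}\ne v_i$ for $i=1,\dots,n$; its weight is $h(w)=\prod_{i=1}^n h(\{v_{i-1},v_i\})$ (and $h(w)=1$ if $n=0$). For a set $W$ of walks, $h(W)$ denotes the sum of $\sum_{w\in W}h(w)$ when it converges absolutely. $W(n)$ is the set of walks of length $n$ with $v_0=1$. The weight $h$ is light if $\sum_{w\in W(n)}h(w)$ converges absolutely for every $n\in\mathbb{N}_0$. Define $A_h(x)=\sum_{n\ge0}a_n^hx^n$ with $a_n^h=h(W(1,n))$, where $W(1,n)$ is the set of walks in $W(n)$ with $v_i=1$ for some $i\in\{1,\dots,n\}$, and $D_h(x)=\sum_{n\ge0}d_n^hx^n$ with $d_n^h=h(W(n))$. For $U(x)=\sum_{n\ge0}u_nx^n\in\mathbb{R}[[x]]$, $U(1)_1=+\infty$ means $\lim_{n\to\infty}\sum_{j=0}^nu_j=+\infty$. *)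

(* Defs.v *)
From HB Require Import structures.
From mathcomp Require Import all_boot all_order all_algebra finmap.
From mathcomp Require Import all_classical all_reals all_analysis.

Set Implicit Arguments.
Unset Strict Implicit.
Unset Printing Implicit Defensive.

Import Order.TTheory GRing.Theory Num.Theory.
Import numFieldNormedType.Exports.

Local Open Scope classical_set_scope.
Local Open Scope ring_scope.

Definition posnat := {n : nat | (0 < n)%N}.
HB.instance Definition _ := Countable.on posnat.

Definition one_pos : posnat := exist _ 1%N isT.

Definition pairs := {e : {fset posnat} | #|` e| == 2%N}.
HB.instance Definition _ := Countable.on pairs.

Lemma edge_subproof (u v : posnat) : u != v -> #|` [fset u; v]%fset| == 2%N.
Proof. by rewrite cardfs2 => ->. Qed.

Definition edge (u v : posnat) (uv : u != v) : pairs :=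
  exist _ [fset u; v]%fset (edge_subproof uv).

(* For [i : 'I_n], the two vertices [v_i] and [v_(i+1)] joined by a step of
   the tuple [<v_0, ..., v_n>]. *)
Definition step_src n (w : n.+1.-tuple posnat) (i : 'I_n) : posnat :=
  tnth w (widen_ord (leqnSn n) i).
Definition step_tgt n (w : n.+1.-tuple posnat) (i : 'I_n) : posnat :=
  tnth w (lift ord0 i).

Definition walk n :=
  {w : n.+1.-tuple posnat | [forall i : 'I_n, step_src w i != step_tgt w i]}.
HB.instance Definition _ n := Countable.on (walk n).

Definition vertex n (w : walk n) (i : 'I_n.+1) : posnat := tnth (val w) i.

Definition walk_edge n (w : walk n) (i : 'I_n) : pairs :=
  edge (forallP (valP w) i).

Section weights.
Variable R : realType.

Definition weight := pairs -> R.

Definition walk_weight (h : weight) n (w : walk n) : R :=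
  \prod_(i < n) h (walk_edge w i).

(* The sum of an absolutely convergent family, as the difference of the sums of
   its positive and negative parts; without absolute convergence the value is
   meaningless. *)
Definition set_weight (h : weight) n (W : set (walk n)) : R :=
  let f := fun w : walk n => (walk_weight h w)%:E in
  fine (\esum_(w in W) (f^\+)%E w - \esum_(w in W) (f^\-)%E w)%E.

Definition walks_from1 n : set (walk n) := [set w | vertex w ord0 = one_pos].

Definition walks_return1 n : set (walk n) :=
  [set w | walks_from1 w /\
           exists i : 'I_n.+1, (0 < i)%N /\ vertex w i = one_pos].

Definition light (h : weight) : Prop :=
  forall n, summable (@walks_from1 n) (fun w => (walk_weight h w)%:E).

(* The power series A_h and D_h, as their sequences of coefficients. *)
Definition A_coef (h : weight) : R^nat :=
  fun n => set_weight h (@walks_return1 n).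
Definition D_coef (h : weight) : R^nat :=
  fun n => set_weight h (@walks_from1 n).

(* U(1)_1 = +oo, for the power series U with coefficients u. *)
Definition sum_at1_pinfty (u : R^nat) : Prop :=
  (\sum_(0 <= j < n.+1) u j) @[n --> \oo] --> +oo%R.

End weights.

(* Main.v *)
Require Import Defs.
From mathcomp Require Import all_boot all_order all_algebra.
From mathcomp Require Import all_classical all_reals all_analysis.
Import Order.TTheory GRing.Theory Num.Theory.
Local Open Scope ring_scope.

(* If [h] vanishes on every edge at 1, only the empty walk contributes to
   D_h(1), which is then finite.  Otherwise h({1,v}) > 0 for some [v], and
   prepending the excursion 1, v to a walk from 1 turns it into a walk that
   returns to 1, so that a_(n+2) >= h({1,v})^2 d_n. *)

Local Open Scope classical_set_scope.

Section esum_extra.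
Context {R : realType} {T : choiceType}.
Implicit Types (I J : set T) (a : T -> \bar R).

Lemma esum_pZl I a (r : R) : 0 < r -> (forall i, (0 <= a i)%E) ->
  \esum_(i in I) (r%:E * a i)%E = (r%:E * \esum_(i in I) a i)%E.
Proof.
move=> r0 a0; rewrite /esum -ereal_sup_pZl//; congr ereal_sup.
apply/seteqP; split=> x /=.
  move=> [X IX <-]; exists (\sum_(i \in X) a i)%E; first by exists X.
  by rewrite ge0_mule_fsumr.
by move=> [_ [X IX <-] <-]; exists X => //; rewrite ge0_mule_fsumr.
Qed.

Lemma subset_esum {I J} a : I `<=` J ->
  (\esum_(i in I) a i <= \esum_(i in J) a i)%E.
Proof.
move=> IJ; apply: le_ereal_sup => _ [X [finX XI] <-].
by exists X => //; split=> //; apply: subset_trans IJ.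
Qed.

End esum_extra.

(** The proof argument of [edge] mentions both endpoints, so these cannot be rewritten alone.
    Boolean irrelevance lets endpoints and proof change together. *)
Lemma eq_edge {u v u' v' : posnat} (uv : u != v) (uv' : u' != v') :
  u = u' -> v = v' -> edge uv = edge uv'.
Proof.
by move=> eu ev; subst u' v'; congr edge; exact: bool_irrelevance.
Qed.

Lemma edgeC {u v : posnat} (uv : u != v) (vu : v != u) : edge uv = edge vu.
Proof. by apply: val_inj => /=; rewrite finmap.fsetUC. Qed.

Lemma vertex_inj {n} {w w' : walk n} : vertex w =1 vertex w' -> w = w'.
Proof. by move=> ww'; apply/val_inj/eq_from_tnth. Qed.

Lemma walk_step n (w : walk n) (i : 'I_n) :
  vertex w (widen_ord (leqnSn n) i) != vertex w (lift ord0 i).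
Proof. exact: (forallP (valP w) i). Qed.

Lemma walk_of_vertices_subproof {n} {f : 'I_n.+1 -> posnat} :
  (forall i : 'I_n, f (widen_ord (leqnSn n) i) != f (lift ord0 i)) ->
  [forall i : 'I_n, step_src (mktuple f) i != step_tgt (mktuple f) i].
Proof.
by move=> fP; apply/forallP => i; rewrite /step_src /step_tgt !tnth_mktuple.
Qed.

Definition walk_of_vertices {n} (f : 'I_n.+1 -> posnat)
    (fP : forall i : 'I_n, f (widen_ord (leqnSn n) i) != f (lift ord0 i)) : walk n :=
  exist _ (mktuple f) (walk_of_vertices_subproof fP).

Lemma vertex_walk_of_vertices {n} {f : 'I_n.+1 -> posnat} fP :
  vertex (@walk_of_vertices n f fP) =1 f.
Proof. by move=> i; rewrite /vertex tnth_mktuple. Qed.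

(** Step [i] of a beheaded walk is thereby step [i + 1] of the original one. *)
Lemma widen_lift0 n (i : 'I_n) :
  lift ord0 (widen_ord (leqnSn n) i) = widen_ord (leqnSn n.+1) (lift ord0 i).
Proof. exact: val_inj. Qed.

Lemma walk_behead_subproof {n} (w : walk n.+1) (i : 'I_n) :
  vertex w (lift ord0 (widen_ord (leqnSn n) i)) !=
  vertex w (lift ord0 (lift ord0 i)).
Proof. by rewrite widen_lift0; exact: walk_step. Qed.

Definition walk_behead {n} (w : walk n.+1) : walk n :=
  walk_of_vertices (fun i => vertex w (lift ord0 i)) (walk_behead_subproof w).

Lemma vertex_behead n (w : walk n.+1) (i : 'I_n.+1) :
  vertex (walk_behead w) i = vertex w (lift ord0 i).
Proof. exact: vertex_walk_of_vertices. Qed.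

(** This is surjectivity of [walk_behead], and [walk_behead_inj] is its injectivity once the first
    vertex is fixed. Together they give the bijection used in [esum_prepend]. *)
Lemma walk_cons_exists {n} {u : posnat} {w : walk n} : u != vertex w ord0 ->
  exists w' : walk n.+1, vertex w' ord0 = u /\ walk_behead w' = w.
Proof.
move=> uw; pose f i := if unlift ord0 i is Some j then vertex w j else u.
have fP (i : 'I_n.+1) : f (widen_ord (leqnSn n.+1) i) != f (lift ord0 i).
  (* A step is either a step of [w] shifted by one, or the new first step, where [uw] applies. *)
  rewrite /f liftK; case: (unliftP ord0 i) => [j|] ->.
    by rewrite -widen_lift0 liftK; exact: walk_step.
  by rewrite (_ : widen_ord _ _ = ord0) ?unlift_none//; exact: val_inj.
exists (walk_of_vertices f fP); split.
  by rewrite vertex_walk_of_vertices /f unlift_none.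
apply: vertex_inj => i.
by rewrite vertex_behead vertex_walk_of_vertices /f liftK.
Qed.

Lemma walk_behead_inj {n} {w w' : walk n.+1} :
  vertex w ord0 = vertex w' ord0 -> walk_behead w = walk_behead w' -> w = w'.
Proof.
move=> w0 ww'; apply: vertex_inj => i.
by case: (unliftP ord0 i) => [j|] ->//; rewrite -!vertex_behead ww'.
Qed.

Section walk_weights.
Context {R : realType}.
Variable h : weight R.

Lemma walk_weight_behead n (w : walk n.+1) :
  walk_weight h w = h (walk_edge w ord0) * walk_weight h (walk_behead w).
Proof.
rewrite /walk_weight big_ord_recl; congr (_ * _); apply: eq_bigr => i _.
congr h; apply: eq_edge.
  by rewrite -[LHS]/(vertex w _) -widen_lift0 -vertex_behead.
by rewrite -[LHS]/(vertex w _) -vertex_behead.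
Qed.

Lemma walk_edge0 {n} {w : walk n.+1} {u v : posnat} (uv : u != v) :
  vertex w ord0 = u -> vertex (walk_behead w) ord0 = v ->
  walk_edge w ord0 = edge uv.
Proof.
rewrite vertex_behead => wu wv; apply: eq_edge => //.
by rewrite -wu; congr (tnth _ _); exact: val_inj.
Qed.

Hypothesis h_ge0 : forall e, 0 <= h e.

Lemma walk_weight_ge0 n (w : walk n) : 0 <= walk_weight h w.
Proof. exact: prodr_ge0. Qed.

(** Beheading maps the left-hand set bijectively onto [Q], since [u] may be put before any walk
    starting at [v]. Each weight then loses the same factor, that of the first edge. *)
Lemma esum_prepend {n} {u v : posnat} (uv : u != v) (Q : set (walk n)) :
  0 < h (edge uv) -> (forall w, Q w -> vertex w ord0 = v) ->
  \esum_(w in [set w | vertex w ord0 = u /\ Q (walk_behead w)])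
    (walk_weight h w)%:E =
  ((h (edge uv))%:E * \esum_(w in Q) (walk_weight h w)%:E)%E.
Proof.
move=> hgt0 Qv; rewrite -esum_pZl//; last first.
  by move=> w; rewrite lee_fin walk_weight_ge0.
rewrite (reindex_esum [set w | vertex w ord0 = u /\ Q (walk_behead w)] Q
           (walk_behead)).
  apply: eq_esum => w [wu /Qv wv].
  by rewrite walk_weight_behead (walk_edge0 uv wu wv) EFinM.
split=> [w []//|w w' /set_mem[wu _] /set_mem[w'u _]|w Qw] /=.
  by apply: walk_behead_inj; rewrite wu w'u.
have /walk_cons_exists[w' [w'u w'w]] : u != vertex w ord0 by rewrite (Qv w Qw).
by exists w' => //=; rewrite w'w.
Qed.

(** The weights are nonnegative, so the negative part contributes 0. *)
Lemma set_weightE n (W : set (walk n)) :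
  set_weight h W = fine (\esum_(w in W) (walk_weight h w)%:E)%E.
Proof.
have w0 (w : walk n) : (0 <= (walk_weight h w)%:E)%E.
  by rewrite lee_fin walk_weight_ge0.
rewrite /set_weight (@esum1 _ _ _ (funeneg _)) ?sube0.
  congr fine; apply: eq_esum => w _.
  by rewrite (@ge0_funeposE _ _ setT)// inE.
by move=> w _; rewrite (@ge0_funenegE _ _ setT)// inE.
Qed.

Lemma A_coef_ge0 n : 0 <= A_coef h n.
Proof.
rewrite /A_coef set_weightE fine_ge0// esum_ge0// => w _.
by rewrite lee_fin walk_weight_ge0.
Qed.

(** The first edge of a walk of positive length from 1 contains 1 and contributes a zero factor. *)
Lemma D_coefS_eq0 n :
  (forall (v : posnat) (uv : one_pos != v), h (edge uv) = 0) ->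
  D_coef h n.+1 = 0.
Proof.
move=> h1; rewrite /D_coef set_weightE esum1// => w w1.
have uv : one_pos != vertex (walk_behead w) ord0.
  rewrite -w1 vertex_behead (_ : ord0 = widen_ord (leqnSn n.+1) ord0).
    exact: walk_step.
  exact: val_inj.
by rewrite walk_weight_behead (walk_edge0 uv w1 erefl) h1 mul0r.
Qed.

Hypothesis h_light : light h.

(** Lightness is used here: it ensures that [fine] preserves the sums to be compared, where an
    infinite one would be read as 0. *)
Lemma esum_walks_fin_num n (W : set (walk n)) : W `<=` @walks_from1 n ->
  \esum_(w in W) (walk_weight h w)%:E \is a fin_num.
Proof.
move=> W1; have w0 (w : walk n) : (0 <= (walk_weight h w)%:E)%E.
  by rewrite lee_fin walk_weight_ge0.
rewrite ge0_fin_numE ?esum_ge0//.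
apply: le_lt_trans (subset_esum _ W1) _.
apply: le_lt_trans (h_light n).
by apply: le_esum => w _; rewrite lee_abs.
Qed.

Lemma le_A_coef n (v : posnat) (uv : one_pos != v) : 0 < h (edge uv) ->
  h (edge uv) ^+ 2 * D_coef h n <= A_coef h n.+2.
Proof.
move=> hgt0; have vu : v != one_pos by rewrite eq_sym.
have hvu : 0 < h (edge vu) by rewrite (edgeC vu uv).
rewrite /A_coef /D_coef !set_weightE -lee_fin EFinM.
rewrite !fineK; last 2 first.
- by apply: esum_walks_fin_num => w [].
- exact: esum_walks_fin_num.
(* The inner factor, with its edge reversed, prepends [v] to the walks from 1; the outer one then
   prepends 1. *)
rewrite expr2 EFinM -muleA -{2}(edgeC vu uv) -esum_prepend// -esum_prepend//; last first.
  by move=> w [].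
apply: subset_esum => w [w1 [_ w2]]; split=> //.
(* Index 2 is where the original walk starts, hence a visit to 1. *)
exists (lift ord0 (lift ord0 ord0)); split=> //.
by rewrite -!vertex_behead.
Qed.

End walk_weights.

Theorem theorem3 (R : realType) (h : weight R) (h_ge0 : forall e, 0 <= h e)
  (h_light : light h) (hD : sum_at1_pinfty (D_coef h)) :
  sum_at1_pinfty (A_coef h).
Proof.
have [[v [uv hgt0]]|h1] :=
    pselect (exists v : posnat, exists uv : one_pos != v, 0 < h (edge uv)).
  (* The threshold for D is scaled so that multiplication by the squared edge weight gives back
     [K]. *)
  apply/cvgryPge => K; move/cvgryPge: hD => /(_ (K / h (edge uv) ^+ 2))[N _ DN].
  (* The coefficients of A are shifted by two against those of D; the first two are nonnegative and
     are dropped. *)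
  exists N.+2 => // -[|[|n]]// Nn.
  have := DN n Nn; rewrite /= ler_pdivrMr ?exprn_gt0// mulrC mulr_sumr.
  move=> /le_trans; apply; rewrite big_nat_recl// big_nat_recl//.
  rewrite addrA ler_wpDl ?addr_ge0 ?A_coef_ge0//.
  by apply: ler_sum => i _; exact: le_A_coef.
have h0 (v : posnat) (uv : one_pos != v) : h (edge uv) = 0.
  apply/eqP; rewrite eq_le h_ge0 andbT leNgt.
  by apply/negP => hgt0; apply: h1; exists v, uv.
(* All partial sums of D now equal the constant coefficient, so they never reach that coefficient
   plus 1. *)
move/cvgryPge: hD => /(_ (D_coef h 0%N + 1))[N _ /(_ N (leqnn N))] /=.
rewrite big_nat_recl// big1 ?addr0 ?gerDl ?ler10// => i _.
exact: D_coefS_eq0.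
Qed.
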